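(* If $k\ge 4$ is even then there exists a maximal $\mathcal{NAS}_k(2)$.
   Context: For a sequence $S=(s_i)_{i\ge0}$ with entries in $\mathbb{Z}_k$ write $\mathbf{s}_n(i)=(s_i,\dots,s_{i+n-1})$; an $n$-tuple occurs in $S$ if it equals $\mathbf{s}_n(i)$ for some $i$. A $k$-ary $n$-window sequence is a periodic sequence over $\mathbb{Z}_k$, of period $m$ say, such that $\mathbf{s}_n(i)=\mathbf{s}_n(j)$ implies $i\equiv j\pmod m$. For $k\ge3$, $n\ge2$, an $\mathcal{NAS}_k(n)$ ($k$-ary Negative Avoiding Sequence of span $n$) is a $k$-ary $n$-window sequence $S$ such that whenever an $n$-tuple $\mathbf{a}=(a_0,\dots,a_{n-1})$ occurs in $S$, its negative $-\mathbf{a}=(-a_0,\dots,-a_{n-1})$ does not occur in $S$. An $\mathcal{NAS}_k(n)$ is maximal if its period equals $\frac{k^n-1}{2}$ when $k$ is odd, or $\frac{k^n-2^n}{2}$ when $k$ is even. *)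

(* Defs.v *)
From mathcomp Require Import all_boot all_order all_algebra.

Set Implicit Arguments.
Unset Strict Implicit.
Unset Printing Implicit Defensive.

Import GRing.Theory.

(* 'Z_k is the ring of integers modulo k only for k >= 2; negative avoiding
   sequences are considered for k >= 3 and n >= 2 only. *)

Definition window (k n : nat) (S : nat -> 'Z_k) (i : nat) : n.-tuple 'Z_k :=
  [tuple S (i + j)%N | j < n].

Definition occurs (k n : nat) (S : nat -> 'Z_k) (a : n.-tuple 'Z_k) : Prop :=
  exists i : nat, a = window n S i.

Definition neg_tuple (k n : nat) (a : n.-tuple 'Z_k) : n.-tuple 'Z_k :=
  [tuple (- tnth a j)%R | j < n].

Definition has_period (k : nat) (S : nat -> 'Z_k) (m : nat) : Prop :=
  (0 < m)%N /\ forall i : nat, S (i + m)%N = S i.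

(* The last clause forces m to be the least period of S; see
   window_sequence_least_period. *)
Definition window_sequence (k n : nat) (S : nat -> 'Z_k) (m : nat) : Prop :=
  has_period S m /\
  forall i j : nat, window n S i = window n S j -> i = j %[mod m].

Lemma window_sequence_least_period (k n : nat) (S : nat -> 'Z_k) (m p : nat) :
  window_sequence n S m -> has_period S p -> (m <= p)%N.
Proof.
move=> [_ inj] [p_gt0 perS]; apply: dvdn_leq => //.
have /inj : window n S p = window n S 0.
  by apply: eq_from_tnth => j; rewrite !tnth_mktuple add0n addnC perS.
by rewrite mod0n => /eqP.
Qed.

Definition NAS (k n : nat) (S : nat -> 'Z_k) (m : nat) : Prop :=
  window_sequence n S m /\
  forall a : n.-tuple 'Z_k, occurs S a -> ~ occurs S (neg_tuple a).

Definition maximal_NAS (k n : nat) (S : nat -> 'Z_k) : Prop :=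
  NAS n S (if odd k then (k ^ n - 1) %/ 2 else (k ^ n - 2 ^ n) %/ 2)%N.

(* Main.v *)
Require Import Defs.
From mathcomp Require Import all_boot all_order all_algebra.
From mathcomp Require Import zify.

(* Consecutive terms of a sequence are arcs on the vertex set Z_k, where
   k = 2h, so one needs a closed walk using exactly one arc of each pair
   {(a, b), (-a, -b)} with (a, b) <> (-a, -b). For 0 < m < h the closed walk
   0, m, m, -m, h, m, 0 meets once every such pair whose arcs lie within
   {0, h, m, -m}; for m < j < h the closed walk m, j, m, -j, m meets once every
   pair joining {m, -m} to {j, -j}. Insert the latter walks into the former ones
   at m, and concatenate the results at 0. The walk so obtained meets every
   pair, and its length is the number of pairs, so it meets each pair once. *)

Set Implicit Arguments.
Unset Strict Implicit.
Unset Printing Implicit Defensive.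

Import GRing.Theory.
Local Open Scope ring_scope.

(** [rot 1] pairs the last entry with the first: a list stands for a closed walk whose base point is
    written only once. *)
Definition arcs (T : Type) (s : seq T) : seq (T * T) := zip s (rot 1 s).

(** Each block starts at [x] but omits its return to [x]; the next block, or whatever is appended,
    supplies it. *)
Definition excursions (T I : Type) (x : T) (F : I -> seq T) (r : seq I) : seq T :=
  flatten [seq x :: F i | i <- r].

Lemma infix_excursions (T I : eqType) (x : T) (F : I -> seq T) (r : seq I) i :
  i \in r -> infix (x :: rcons (F i) x) (rcons (excursions x F r) x).
Proof.
case/splitPr=> r1 r2; rewrite /excursions map_cat flatten_cat /= rcons_cat.
set t := flatten [seq _ | _ <- r2]; have [t' et] : exists t', rcons t x = x :: t'.
  by rewrite /t {t}; case: r2 => [|j r2]; eexists; reflexivity.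
apply/infixP; exists (flatten [seq x :: F j | j <- r1]), t'.
by rewrite /= rcons_cat et cat_rcons.
Qed.

(** Repeating the base point at the end unrolls the closed walk, so that the closing arc too becomes
    an infix of length two. *)
Lemma mem_arcs (T : eqType) (x y z : T) (s : seq T) :
  infix [:: y; z] (rcons (x :: s) x) -> (y, z) \in arcs (x :: s).
Proof.
case/infixP=> p [q e].
have lt_p : (size p < size (x :: s))%N.
  by have := congr1 size e; rewrite size_rcons !size_cat /=; lia.
have <- : nth (x, x) (arcs (x :: s)) (size p) = (y, z).
  rewrite nth_zip ?size_rot // rot1_cons; congr pair.
    by have := congr1 (nth x ^~ (size p)) e; rewrite nth_rcons lt_p nth_cat ltnn subnn.
  have := congr1 (nth x ^~ (size p).+1) e.
  by rewrite rcons_cons /= nth_cat ltnNge leqnSn /= subSnn.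
by apply: mem_nth; rewrite size_zip size_rot minnn.
Qed.

Section CyclicSequence.

Variable k : nat.
Implicit Types s : seq 'Z_k.

Definition cyclic_sequence s (i : nat) : 'Z_k := nth 0 s (i %% size s).

Lemma cyclic_sequence_arc s i : (0 < size s)%N ->
  (cyclic_sequence s i, cyclic_sequence s i.+1) = nth (0, 0) (arcs s) (i %% size s).
Proof.
move=> s_gt0; rewrite nth_zip ?size_rot // /cyclic_sequence; congr pair.
have -> : (i.+1 %% size s = (i %% size s).+1 %% size s)%N by rewrite -addn1 -modnDml addn1.
have := ltn_pmod i s_gt0.
case: s s_gt0 => // x s _; move: (i %% _)%N => {}i /= lti.
rewrite rot1_cons nth_rcons; have [lt_is|] := ltnP i (size s).
  by rewrite modn_small.
move=> le_si; have -> : i = size s by lia.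
by rewrite eqxx modnn.
Qed.

(** Two sequences are allowed in order to compare windows of [S] with windows of its negative. *)
Lemma window2_arc (S S' : nat -> 'Z_k) i j :
  window 2 S i = window 2 S' j -> (S i, S i.+1) = (S' j, S' j.+1).
Proof.
move=> e; have [] := (congr1 (fun t => tnth t ord0) e, congr1 (fun t => tnth t ord_max) e).
by rewrite !tnth_mktuple /= !addn0 !addn1 => -> ->.
Qed.

Lemma neg_window (n : nat) (S : nat -> 'Z_k) i :
  neg_tuple (window n S i) = window n (fun j => - S j) i.
Proof. by apply: eq_from_tnth => j; rewrite !tnth_mktuple. Qed.

(** Windows of length two are arcs: distinctness of the arcs gives the window property, and
    disjointness from their negatives gives negative avoidance. *)
Lemma cyclic_sequence_NAS s : (0 < size s)%N ->
  uniq (arcs s ++ [seq - e | e <- arcs s]) ->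
  NAS 2 (cyclic_sequence s) (size s).
Proof.
move=> s_gt0; rewrite cat_uniq => /and3P[uniq_s /hasPn disj _].
have sz : size (arcs s) = size s by rewrite size_zip size_rot minnn.
have ltm i : (i %% size s < size (arcs s))%N by rewrite sz ltn_pmod.
split; first split.
- by split=> // i; rewrite /cyclic_sequence modnDr.
- move=> i j /window2_arc; rewrite !cyclic_sequence_arc // => /eqP.
  by rewrite nth_uniq // => /eqP.
- move=> _ [i ->] [j]; rewrite neg_window => /window2_arc eij.
  have : (cyclic_sequence s j, cyclic_sequence s j.+1) \in [seq - e | e <- arcs s].
    rewrite -eij; apply/mapP; exists (nth (0, 0) (arcs s) (i %% size s)).
      exact: mem_nth.
    by rewrite -cyclic_sequence_arc.
  by move/disj; rewrite cyclic_sequence_arc // mem_nth.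
Qed.

End CyclicSequence.

Section EvenWalk.

Variable h : nat.
Hypothesis h_gt1 : (1 < h)%N.
Notation k := h.*2.
Notation Z := 'Z_k.

(** The leading 0 is left to [even_walk]. The [iota] runs over m < j < h, so that {m, -m} and {j,
    -j} are joined at the smaller index only. *)
Definition petal (m : nat) : seq Z :=
  excursions m%:R (fun j : nat => [:: j%:R; m%:R; - j%:R]) (iota m.+1 (h.-1 - m))
  ++ [:: m%:R; m%:R; - m%:R; h%:R; m%:R].

Definition even_walk : seq Z := excursions 0 petal (iota 1 h.-1).

Lemma even_walk_cons : exists s, even_walk = 0 :: s.
Proof.
have : (0 < h.-1)%N by lia.
by rewrite /even_walk; case: h.-1 => // n _; eexists; reflexivity.
Qed.

(** With k = 2h this is (k^2 - 4) / 2; the petal of m, with its leading 0, contributes 4(h - 1 - m)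
    + 6 entries. *)
Lemma size_even_walk : size even_walk = (2 * (h.-1 * h.+1))%N.
Proof.
have size_petal m : size (petal m) = (4 * (h.-1 - m) + 5)%N.
  rewrite size_cat; congr addn; rewrite /excursions size_flatten /shape -map_comp.
  rewrite sumnE big_map (eq_bigr (fun=> 4)%N) //.
  by rewrite big_const_seq count_predT size_iota iter_addn_0 mulnC.
rewrite /even_walk /excursions size_flatten /shape -map_comp sumnE big_map.
rewrite (eq_bigr (fun m => 4 * (h.-1 - m) + 6)%N); last first.
  by move=> m _; rewrite /= size_petal -addnS.
(* The start [a] varies while the top [a + n.-1] stays fixed, so removing the first term leaves a
   sum of the same form. *)
have sum_iota n a : (\sum_(m <- iota a n) (4 * (a + n.-1 - m) + 6) = 2 * (n * (n + 2)))%N.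
  elim: n a => [|n IH] a; first by rewrite big_nil.
  rewrite /= big_cons; under eq_big_seq => m.
    rewrite mem_iota => /andP[ltam ltmn]; have -> : (a + n - m = a.+1 + n.-1 - m)%N by lia.
    over.
  by rewrite IH; lia.
have := sum_iota h.-1 1%N; have -> : (1 + h.-1.-1 = h.-1)%N by lia.
by move->; have -> : h.+1 = (h.-1 + 2)%N by lia.
Qed.

Lemma Zp_double_cases (a : Z) :
  [\/ a = 0, a = h%:R, exists2 m, (0 < m < h)%N & a = m%:R
    | exists2 m, (0 < m < h)%N & a = - m%:R].
Proof.
have lt_ak : (a < k)%N.
  by apply: leq_trans (ltn_ord a) _; rewrite Zp_cast //; lia.
rewrite -(natr_Zp a); move: (nat_of_ord a) lt_ak => n ltn.
case: (posnP n) => [->|n_gt0]; first by constructor 1.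
case: (ltngtP n h) => [lt_nh|lt_hn|->]; last by constructor 2.
  by constructor 3; exists n; rewrite ?n_gt0.
constructor 4; exists (k - n)%N; first by lia.
rewrite natrB; last by lia.
by rewrite pchar_Zp ?sub0r ?opprK //; lia.
Qed.

Lemma opp_half : - h%:R = h%:R :> Z.
Proof.
apply/eqP; rewrite -subr_eq0 -opprD oppr_eq0 -natrD addnn pchar_Zp //; lia.
Qed.

Lemma even_walk_infix (t : seq Z) (m : nat) (a b : Z) : (0 < m < h)%N ->
  infix t (0 :: rcons (petal m) 0) -> infix [:: a; b] t -> (a, b) \in arcs even_walk.
Proof.
move=> hm inft infab; have [s es] := even_walk_cons; rewrite es.
apply: mem_arcs; rewrite -es; apply: infix_trans infab _.
apply: infix_trans inft _; apply: infix_excursions; rewrite mem_iota; lia.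
Qed.

Lemma petal_core m (a b : Z) : (0 < m < h)%N ->
  infix [:: a; b] [:: m%:R; m%:R; - m%:R; h%:R; m%:R; 0] ->
  (a, b) \in arcs even_walk.
Proof.
move=> hm; apply: even_walk_infix (hm) _.
by rewrite /petal rcons_cat -cat_cons suffix_infix // suffix_suffix.
Qed.

Lemma petal_start m : (0 < m < h)%N -> (0, m%:R) \in arcs even_walk.
Proof.
move=> hm; have := @even_walk_infix [:: 0; m%:R] m 0 m%:R hm; apply; last exact: infix_refl.
(* The petal starts with m even when it has no excursions, as for m = h - 1. *)
have [s ->] : exists s, petal m = m%:R :: s.
  by rewrite /petal; case: (h.-1 - m)%N => [|n] /=; eexists; reflexivity.
by apply: prefix_infix; rewrite /= !eqxx.
Qed.

Lemma petal_excursion m j (a b : Z) : (0 < m < j)%N -> (j < h)%N ->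
  infix [:: a; b] [:: m%:R; j%:R; m%:R; - j%:R; m%:R] ->
  (a, b) \in arcs even_walk.
Proof.
move=> /andP[m_gt0 ltmj] ltjh; apply: (@even_walk_infix _ m); first by lia.
have jr : j \in iota m.+1 (h.-1 - m) by rewrite mem_iota; lia.
have := @infix_excursions Z nat m%:R (fun j : nat => [:: j%:R; m%:R; - j%:R : Z]) _ _ jr.
move/infix_trans; apply; apply/infixP.
(* The first m of the final stretch of the petal is missing here: it closes the last excursion. *)
exists [:: 0], [:: m%:R; - m%:R; h%:R; m%:R; 0].
by rewrite /petal rcons_cat cat_rcons.
Qed.

Lemma arc_pos_pos m j : (0 < m < h)%N -> (0 < j < h)%N ->
  (m%:R, j%:R) \in arcs even_walk.
Proof.
move=> hm hj; case: (ltngtP m j) => [lt_mj|lt_jm|<-].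
- by apply: (@petal_excursion m j); rewrite /= ?eqxx //; lia.
- by apply: (@petal_excursion j m); rewrite /= ?eqxx ?orbT //; lia.
- by apply: (petal_core hm); rewrite /= !eqxx.
Qed.

(** Excursions are made from the smaller index, so the order of m and j decides which of the two
    opposite arcs is used. *)
Lemma arc_pos_neg m j : (0 < m < h)%N -> (0 < j < h)%N ->
  (m%:R, - j%:R) \in arcs even_walk \/ (- m%:R, j%:R) \in arcs even_walk.
Proof.
move=> hm hj; case: (ltngtP m j) => [lt_mj|lt_jm|<-].
- by left; apply: (@petal_excursion m j); rewrite /= ?eqxx ?orbT //; lia.
- by right; apply: (@petal_excursion j m); rewrite /= ?eqxx ?orbT //; lia.
- by left; apply: (petal_core hm); rewrite /= !eqxx ?orbT.
Qed.

(** The four exceptional arcs are their own negatives, since -h = h modulo 2h. *)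
Lemma even_walk_cover (a b : Z) :
  [\/ (a, b) \in arcs even_walk, (- a, - b) \in arcs even_walk
    | (a, b) \in [:: (0, 0); (0, h%:R); (h%:R, 0); (h%:R, h%:R)]].
Proof.
have to0 m : (0 < m < h)%N -> (m%:R, 0) \in arcs even_walk.
  by move=> hm; apply: (petal_core hm); rewrite /= !eqxx ?orbT.
have from_half m : (0 < m < h)%N -> (h%:R, m%:R) \in arcs even_walk.
  by move=> hm; apply: (petal_core hm); rewrite /= !eqxx ?orbT.
have to_half m : (0 < m < h)%N -> (- m%:R, h%:R) \in arcs even_walk.
  by move=> hm; apply: (petal_core hm); rewrite /= !eqxx ?orbT.
case: (Zp_double_cases a) => [->|->|[m hm ->]|[m hm ->]];
  case: (Zp_double_cases b) => [->|->|[j hj ->]|[j hj ->]];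
  rewrite ?oppr0 ?opprK ?opp_half.
- by constructor 3; rewrite !inE eqxx.
- by constructor 3; rewrite !inE eqxx ?orbT.
- by constructor 1; apply: petal_start.
- by constructor 2; apply: petal_start.
- by constructor 3; rewrite !inE eqxx ?orbT.
- by constructor 3; rewrite !inE eqxx ?orbT.
- by constructor 1; apply: from_half.
- by constructor 2; apply: from_half.
- by constructor 1; apply: to0.
- by constructor 2; apply: to_half.
- by constructor 1; apply: arc_pos_pos.
- by case: (arc_pos_neg hm hj); [constructor 1|constructor 2].
- by constructor 2; apply: to0.
- by constructor 1; apply: to_half.
- by case: (arc_pos_neg hm hj); [constructor 2|constructor 1].
- by constructor 2; apply: arc_pos_pos.
Qed.

End EvenWalk.

Theorem theorem6p4 (k : nat) (hk : (4 <= k)%N) (hev : ~~ odd k) :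
  exists S : nat -> 'Z_k, maximal_NAS 2 S.
Proof.
have [h ek] : exists h, k = h.*2 by exists k./2; rewrite even_halfK.
subst k; have h_gt1 : (1 < h)%N by lia.
exists (cyclic_sequence (even_walk h)); rewrite /maximal_NAS (negPf hev).
have sz := size_even_walk h_gt1.
have -> : ((h.*2 ^ 2 - 2 ^ 2) %/ 2)%N = size (even_walk h).
  by rewrite sz; case: h h_gt1 {hk hev sz} => // n _; rewrite /= !expnS expn0; nia.
apply: cyclic_sequence_NAS; first by rewrite sz; nia.
(* With the four self-negative arcs added, the list covers all of ['Z_k * 'Z_k] and has length 4(h^2
   - 1) + 4 = k^2, so nothing in it is repeated. *)
set s := _ ++ _; suff : uniq (s ++ [:: (0, 0); (0, h%:R); (h%:R, 0); (h%:R, h%:R)]).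
  by rewrite cat_uniq => /andP[].
apply: (leq_size_uniq (enum_uniq {: 'Z_(h.*2) * 'Z_(h.*2)})).
  move=> [a b] _; rewrite !mem_cat -orbA; apply/or3P.
  case: (even_walk_cover h_gt1 a b) => ab; [by constructor 1| |by constructor 3].
  constructor 2; apply/mapP; exists (- a, - b) => //.
  by rewrite -[in LHS](opprK a) -[in LHS](opprK b).
rewrite !size_cat size_map !size_zip size_rot minnn sz -[size [:: _; _; _; _]]/4%N.
rewrite -cardE card_prod card_ord Zp_cast; last by lia.
by case: h h_gt1 {hk hev sz s} => // n _ /=; nia.
Qed.
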